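(* Let $(X,T)$ be a topological dynamical system. Then $(X,T)$ is weak Banach mean equicontinuous if and only if the uniform time averages $f_B^{*}$ are continuous for all $f\in C(X)$ (that is, for every $f\in C(X)$ the limit $f_B^*(x)$ exists for every $x\in X$ and the function $f_B^*$ is continuous on $X$).
   Context: A topological dynamical system $(X,T)$ is a compact metric space $X$ with metric $d$ together with a continuous map $T:X\to X$. $C(X)$ is the space of continuous real-valued functions on $X$. For integers $0\le m<n$, $S_{n,m}$ is the group of permutations of $\{m,m+1,\dots,n-1\}$. For a real family $(a_{m,n})_{0\le m<n}$, $\limsup_{n-m\to+\infty}a_{m,n}=\lim_{N\to\infty}\sup\{a_{m,n}: n-m\ge N\}$, $\liminf_{n-m\to+\infty}$ is defined analogously with $\inf$, and $\lim_{n-m\to+\infty}a_{m,n}$ exists if these agree (and are finite). Define $$\overline{BF}(x,y)=\limsup_{n-m\to+\infty}\ \inf_{\sigma\in S_{n,m}}\frac1{n-m}\sum_{k=m}^{n-1}d(T^kx,T^{\sigma(k)}y).$$ $(X,T)$ is weak Banach mean equicontinuous if for every $x\in X$ and every $\varepsilon>0$ there is $\delta>0$ such that $d(x,y)<\delta$ implies $\overline{BF}(x,y)<\varepsilon$. For $f\in C(X)$ the uniform time average is $f_B^{*}(x)=\lim_{n-m\to+\infty}\frac1{n-m}\sum_{k=m}^{n-1}f(T^kx)$. *)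

(* Defs.v *)
From HB Require Import structures.
From mathcomp Require Import all_boot all_order all_algebra all_fingroup.
From mathcomp Require Import all_classical all_reals all_analysis.

Set Implicit Arguments.
Unset Strict Implicit.
Unset Printing Implicit Defensive.

Import Order.TTheory GRing.Theory Num.Theory.
Import numFieldNormedType.Exports.

Local Open Scope classical_set_scope.
Local Open Scope ring_scope.

(* The condition [p.1 < p.2] is not redundant: [p.2 - p.1] is truncated, so
   for N = 0 it is what rules out the pairs that are not windows. *)
Definition windows (N : nat) : set (nat * nat) :=
  [set p | (p.1 < p.2)%N /\ (N <= p.2 - p.1)%N].

(* Limits superior and inferior as n - m --> +oo of a family (a m n), m < n.
   They are taken in \bar R, where both limits exist by monotonicity in N. *)
Definition limsup_window (R : realType) (a : nat -> nat -> R) : \bar R :=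
  limn (fun N => ereal_sup [set (a p.1 p.2)%:E | p in windows N]).

Definition liminf_window (R : realType) (a : nat -> nat -> R) : \bar R :=
  limn (fun N => ereal_inf [set (a p.1 p.2)%:E | p in windows N]).

Definition has_lim_window (R : realType) (a : nat -> nat -> R) : Prop :=
  limsup_window a = liminf_window a /\ limsup_window a \is a fin_num.

(* Meaningful only when [has_lim_window a] holds. *)
Definition lim_window (R : realType) (a : nat -> nat -> R) : R :=
  fine (limsup_window a).

(* Permutations of {m, ..., n - 1}, encoded as the permutations of
   {0, ..., n - 1} that move no point below m. *)
Definition window_perms (m n : nat) : {set 'S_n} :=
  Sym (finset (fun k : 'I_n => (m <= k)%N)).

Definition BF_window (R : realType) (X : metricType R) (T : X -> X) (x y : X)
    (m n : nat) : R :=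
  inf [set (n - m)%:R^-1 *
           \sum_(k < n | (m <= k)%N) mdist (iter k T x) (iter (s k) T y)
      | s in [set` window_perms m n]].

Definition BF_upper (R : realType) (X : metricType R) (T : X -> X) (x y : X) :
    \bar R :=
  limsup_window (BF_window T x y).

Definition weak_Banach_mean_equicontinuous (R : realType) (X : metricType R)
    (T : X -> X) : Prop :=
  forall (x : X) (e : R), 0 < e ->
    exists2 delta : R, 0 < delta &
      forall y : X, mdist x y < delta -> (BF_upper T x y < e%:E)%E.

Definition time_average (R : realType) (X : Type) (T : X -> X) (f : X -> R)
    (x : X) (m n : nat) : R :=
  (n - m)%:R^-1 * \sum_(m <= k < n) f (iter k T x).

Definition uniform_time_average (R : realType) (X : Type) (T : X -> X)
    (f : X -> R) : X -> R :=
  fun x => lim_window (time_average T f x).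

(* Main.v *)
(** For the forward direction, f differs between two orbits by at most
    e + C d, so a rearrangement of the window gives
    |A f x - A f y| <= e + C BF(x, y): the averages are equicontinuous. Let L be
    the limsup of A f x over windows. The orbit of x contains arbitrarily long
    blocks all of whose initial averages are at least L - e; a cluster point of
    their starting points has all its averages from time 0 at least L - e, and
    equicontinuity at that point transfers the bound to the averages of x over
    [0, p[ for large p. With the same statement for - f, the limsup and the
    liminf over windows both equal the limit over [0, p[.

    Conversely, let s be a permutation of the window leaving as few pairs
    (T^k x, T^(s k) y) as possible at distance >= 3 r. By Hall's theorem with
    deficiency, the number of such pairs is at most |S| - |N(S)| for some set S
    of times. Up to r, S only matters through a subset Q of a finite r-net of X,
    and a plateau function g_Q gives
    |S| - |N(S)| <= (n - m) (A g_Q x - A g_Q y). There are finitely many g_Q, so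
    continuity of their uniform averages bounds this by a small multiple of
    n - m. *)
Require Import Defs.
From HB Require Import structures.
From mathcomp Require Import all_boot all_order all_algebra all_fingroup.
From mathcomp Require Import all_classical all_reals all_analysis.
From mathcomp Require Import lra ring zify.

Set Implicit Arguments.
Unset Strict Implicit.
Unset Printing Implicit Defensive.

Import Order.TTheory GRing.Theory Num.Theory.
Import numFieldNormedType.Exports.

Local Open Scope ring_scope.

(** * Hall's theorem with deficiency, for permutations supported in a finite set *)

Section Deficiency.
Variables (I : finType) (A : {set I}) (e : rel I).
Implicit Types (s : {perm I}) (k b : I) (p : seq I).

Definition matched s : {set I} := [set k in A | e k (s k)].

(* Swapping the partners of the last two rows of an augmenting path either
   matches one more row or leaves a shorter augmenting path. *)
Lemma augmenting_path p s b b' :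
  s \in Sym A -> b \in A :\: matched s -> b' \in A :\: matched s ->
  all (mem (matched s)) p -> uniq p ->
  path (fun k k' => e k (s k')) b (rcons p b') ->
  exists2 t, t \in Sym A & (#|matched s| < #|matched t|)%N.
Proof.
have tpermA s' k k' : s' \in Sym A -> k \in A -> k' \in A ->
    (tperm k k' * s')%g \in Sym A.
  move=> s'A kA k'A; rewrite groupM// inE /perm_on; apply/fintype.subsetP => z.
  by rewrite !inE; case: tpermP => [->|->|_ _] //; rewrite eqxx.
elim/last_ind: p s b' => [|p k IHp] s b' sA bA b'A.
  move=> _ _ /=; rewrite andbT => ebb'.
  move: (bA) (b'A); rewrite !inE => /andP[nb Ab] /andP[nb' Ab'].
  exists (tperm b b' * s)%g; first exact: tpermA.
  apply: proper_card; apply/fintype.properP; split; last first.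
    exists b; last by rewrite !inE.
    by rewrite !inE Ab permM tpermL.
  apply/fintype.subsetP => z; rewrite !inE => /andP[Az ez]; rewrite Az permM.
  case: tpermP ez => [->|->|//]; first by move=> h; case/negP: nb; rewrite Ab.
  by move=> h; case/negP: nb'; rewrite Ab'.
rewrite all_rcons rcons_uniq => /andP[/= km pm] /andP[kp up].
rewrite rcons_path last_rcons => /andP[pathp ekb'].
move: (bA) (b'A) (km); rewrite !inE => /andP[nb Ab] /andP[nb' Ab'] /andP[Ak ek].
have kb' : k != b' by apply: contraNneq nb' => <-; rewrite Ak.
have kb : k != b by apply: contraNneq nb => <-; rewrite Ak.
pose t := (tperm k b' * s)%g.
have tA : t \in Sym A by exact: tpermA.
have tk : t k = s b' by rewrite permM tpermL.
have tb' : t b' = s k by rewrite permM tpermR.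
have tD z : z != k -> z != b' -> t z = s z.
  by move=> zk zb'; rewrite permM tpermD 1?eq_sym.
have sub_st : matched s \subset matched t.
  apply/fintype.subsetP => z; rewrite !inE => /andP[Az ez]; rewrite Az /=.
  have [->|zk] := eqVneq z k; first by rewrite tk.
  rewrite tD//; apply: contraNneq nb' => <-; by rewrite Az.
have [b't|b't] := boolP (b' \in matched t).
  exists t => //; apply: proper_card; apply/fintype.properP; split=> //.
  by exists b' => //; rewrite !inE.
have ms_mt : matched s = matched t.
  apply/eqP; rewrite finset.eqEsubset sub_st; apply/fintype.subsetP => z zt.
  have zb' : z != b' by apply: contraNneq b't => <-.
  have [->//|zk] := eqVneq z k.
  by move: zt; rewrite !inE tD.
rewrite ms_mt; apply: (IHp t b') => //; rewrite -?ms_mt//.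
move: pathp; rewrite !rcons_path tb' => /andP[pathp ->]; rewrite andbT.
(* The other edges end in rows of [p], which differ from [k] by uniqueness and from [b'] because
   they are matched; there [t] agrees with [s]. *)
elim: p b pm kp {IHp up bA nb Ab kb} pathp => //= z p IHp b /andP[zm pm].
rewrite in_cons negb_or => /andP[kz kp] /andP[ebz pathp].
rewrite IHp// andbT tD//; first by rewrite eq_sym.
by apply: contraNneq nb' => <-; move: zm; rewrite !inE.
Qed.

(* S consists of the rows reachable by alternating paths from the unmatched
   rows of a permutation matching as many rows as possible. *)
Lemma hall_deficiency :
  exists2 s, s \in Sym A & exists2 S : {set I}, S \subset A &
  (#|[set k in A | ~~ e k (s k)]| + #|[set j in A | [exists k in S, e k j]]|
    <= #|S|)%N.
Proof.
have [s sA smax] : exists2 s, s \in Sym A &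
    forall t, t \in Sym A -> (#|matched t| <= #|matched s|)%N.
  case: (@arg_maxnP _ 1%g (mem (Sym A)) (fun s => #|matched s|)).
    exact: group1.
  by move=> s sA smax; exists s.
exists s => //.
pose B := A :\: matched s.
have BE : [set k in A | ~~ e k (s k)] = B.
  by apply/setP => k; rewrite !inE; case: (k \in A) => //=; rewrite andbT.
pose E := [rel k k' | (k' \in matched s) && e k (s k')].
pose S := [set k in A | [exists b in B, connect E b k]].
have SA : S \subset A by apply/fintype.subsetP => k; rewrite inE => /andP[].
exists S => //; rewrite BE.
have BS : B \subset S.
  apply/fintype.subsetP => b bB; move: (bB); rewrite !inE => /andP[_ ->] /=.
  by apply/existsP; exists b; rewrite bB connect0.
(* A column adjacent to a reachable row is some [s k']. If [k'] is matched, it is itself reachable;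
   if not, it ends an augmenting path, against the maximality of [s]. *)
have NS : [set j in A | [exists k in S, e k j]] \subset s @: (S :\: B).
  apply/fintype.subsetP => j; rewrite inE.
  move=> /andP[jA /existsP[k /andP[kS ekj]]].
  have [k' k'A jE] : exists2 k', k' \in A & j = s k'.
    exists (s^-1 j)%g; last by rewrite permKV.
    have : perm_on A (s^-1)%g by have := groupVr sA; rewrite inE.
    by move/perm_closed => ->.
  apply/imsetP; exists k' => //.
  move: kS; rewrite inE => /andP[kA /existsP[b /andP[bB /connectP[p pp kE]]]].
  have [k'm|k'm] := boolP (k' \in matched s).
    rewrite inE [X in ~~ X]inE k'm /= inE k'A /=.
    apply/existsP; exists b; rewrite bB /=.
    apply: (@connect_trans _ _ k); first by apply/connectP; exists p.
    by apply: connect1; rewrite /= k'm -jE.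
  exfalso; case/shortenP: pp kE => q pq uq _ kE.
  have k'B : k' \in B by rewrite inE k'm.
  have qm : all (mem (matched s)) q.
    elim: q b {bB kE uq} pq => //= z q IHq b /andP[/andP[-> _] /IHq].
    by [].
  have pq' : path (fun k k' => e k (s k')) b (rcons q k').
    rewrite rcons_path -kE -jE ekj andbT.
    by apply: sub_path pq => z z' /= /andP[].
  have /andP[_ uq'] : (b \notin q) && uniq q by move: uq.
  have [t tA] := augmenting_path sA bB k'B qm uq' pq'.
  by rewrite ltnNge smax.
have := subset_leq_card NS; rewrite card_imset; last exact: perm_inj.
by rewrite cardsD (finset.setIidPr BS); have := subset_leq_card BS; lia.
Qed.

End Deficiency.

Local Open Scope classical_set_scope.
Local Open Scope ring_scope.

(** * Upper and lower limits over windows *)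

Section Windows.
Context {R : realType}.
Implicit Types (a : nat -> nat -> R) (c l e : R) (N m n : nat).

Lemma windows_anti N N' : (N <= N')%N -> windows N' `<=` windows N.
Proof. by move=> NN' [m n] [/= mn N'mn]; split=> //=; lia. Qed.

Lemma limsup_windowE a : limsup_window a =
  ereal_inf (range (fun N => ereal_sup [set (a p.1 p.2)%:E | p in windows N])).
Proof.
apply: cvg_lim => //; apply: ereal_nonincreasing_cvgn => N N' NN'.
by apply: ereal_sup_le; apply: image_subset; exact: windows_anti.
Qed.

Lemma liminf_windowE a : liminf_window a =
  ereal_sup (range (fun N => ereal_inf [set (a p.1 p.2)%:E | p in windows N])).
Proof.
apply: cvg_lim => //; apply: ereal_nondecreasing_cvgn => N N' NN'.
by apply: ereal_inf_le_tmp; apply: image_subset; exact: windows_anti.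
Qed.

Lemma limsup_window_le a c N :
  (forall m n, (m < n)%N -> (N <= n - m)%N -> a m n <= c) ->
  (limsup_window a <= c%:E)%E.
Proof.
move=> ac; rewrite limsup_windowE; apply: ge_ereal_inf.
exists (ereal_sup [set (a p.1 p.2)%:E | p in windows N]); first by exists N.
by apply: ge_ereal_sup => _ [[m n] [/= mn Nmn] <-]; rewrite lee_fin ac.
Qed.

Lemma liminf_window_ge a c N :
  (forall m n, (m < n)%N -> (N <= n - m)%N -> c <= a m n) ->
  (c%:E <= liminf_window a)%E.
Proof.
move=> ac; rewrite liminf_windowE; apply: le_ereal_sup_tmp.
exists (ereal_inf [set (a p.1 p.2)%:E | p in windows N]); first by exists N.
by apply: le_ereal_inf_tmp => _ [[m n] [/= mn Nmn] <-]; rewrite lee_fin ac.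
Qed.

Lemma limsup_window_lt a c : (limsup_window a < c%:E)%E ->
  exists N, forall m n, (m < n)%N -> (N <= n - m)%N -> a m n < c.
Proof.
rewrite limsup_windowE => /ereal_inf_lt[_ [N _ <-]] supc.
exists N => m n mn Nmn; rewrite -lte_fin; apply: le_lt_trans supc.
by apply: ereal_sup_ubound; exists (m, n).
Qed.

Lemma liminf_window_gt a c : (c%:E < liminf_window a)%E ->
  exists N, forall m n, (m < n)%N -> (N <= n - m)%N -> c < a m n.
Proof.
rewrite liminf_windowE => /ereal_sup_gt[_ [N _ <-]] cinf.
exists N => m n mn Nmn; rewrite -lte_fin; apply: (lt_le_trans cinf).
by apply: ereal_inf_lbound; exists (m, n).
Qed.


Definition cvg_window a l := forall e, 0 < e ->
  exists N, forall m n, (m < n)%N -> (N <= n - m)%N -> `|a m n - l| <= e.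

Lemma has_lim_windowP a l :
  has_lim_window a /\ lim_window a = l <-> cvg_window a l.
Proof.
split=> [[[eqa fina] <-] e e0|al].
  have [N1 aN1] : exists N, forall m n, (m < n)%N -> (N <= n - m)%N ->
      a m n < lim_window a + e.
    by apply: limsup_window_lt; rewrite EFinD fineK// lteDl.
  have [N2 aN2] : exists N, forall m n, (m < n)%N -> (N <= n - m)%N ->
      lim_window a - e < a m n.
    by apply: liminf_window_gt; rewrite -eqa -[ltRHS]fineK// lte_fin gtrBl.
  exists (maxn N1 N2) => m n mn; rewrite geq_max => /andP[N1mn N2mn].
  by rewrite ler_norml; have := aN1 m n mn N1mn; have := aN2 m n mn N2mn; lra.
have le_sup : (limsup_window a <= l%:E)%E.
  apply/lee_addgt0Pr => e e0; have [N aN] := al e e0.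
  rewrite -EFinD; apply: (@limsup_window_le _ _ N) => m n mn Nmn.
  by have := aN m n mn Nmn; rewrite ler_norml; lra.
have ge_inf : (l%:E <= liminf_window a)%E.
  apply/lee_subgt0Pr => e e0; have [N aN] := al e e0.
  rewrite -EFinB; apply: (@liminf_window_ge _ _ N) => m n mn Nmn.
  by have := aN m n mn Nmn; rewrite ler_norml; lra.
have inf_sup : (liminf_window a <= limsup_window a)%E.
  rewrite limsup_windowE liminf_windowE.
  apply: ge_ereal_sup => _ [N1 _ <-]; apply: le_ereal_inf_tmp => _ [N2 _ <-].
  (* The window [[0, N[] is long enough for both bounds; the successor keeps it nonempty when [N1]
     and [N2] are 0. *)
  pose N := (maxn N1 N2).+1.
  apply: (@le_trans _ _ (a 0 N)%:E).
    apply: ereal_inf_lbound; exists (0, N)%N => //.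
    by split=> //=; rewrite /N; lia.
  apply: ereal_sup_ubound; exists (0, N)%N => //.
  by split=> //=; rewrite /N; lia.
have supE : limsup_window a = l%:E.
  by apply/eqP; rewrite eq_le le_sup (le_trans ge_inf).
split; last by rewrite /lim_window supE.
split; last by rewrite supE.
by apply/eqP; rewrite eq_le inf_sup andbT supE.
Qed.

(** Boundedness makes the limsup finite, so a real [l] can stand for it, described by its two
    defining properties: eventually below [l + e], and above [l - e] on arbitrarily long windows. *)
Lemma limsup_window_bounded a M :
  (forall m n, (m < n)%N -> `|a m n| <= M) ->
  exists l, forall e, 0 < e ->
    (exists N, forall m n, (m < n)%N -> (N <= n - m)%N -> a m n < l + e) /\
    (forall N, exists m n, [/\ (m < n)%N, (N <= n - m)%N & l - e < a m n]).
Proof.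
move=> aM.
have fina : limsup_window a \is a fin_num.
  rewrite fin_numE; apply/andP; split; last first.
    rewrite -ltey; apply: (@le_lt_trans _ _ M%:E); last by rewrite ltry.
    apply: (@limsup_window_le _ _ 0%N) => m n mn _.
    by have := aM m n mn; rewrite ler_norml => /andP[].
  rewrite -ltNye; apply: (@lt_le_trans _ _ (- M)%:E); first by rewrite ltNyr.
  rewrite limsup_windowE; apply: le_ereal_inf_tmp => _ [N _ <-].
  apply: (@le_trans _ _ (a 0 N.+1)%:E).
    by rewrite lee_fin; have := aM 0%N N.+1 isT; rewrite ler_norml => /andP[].
  by apply: ereal_sup_ubound; exists (0, N.+1)%N => //; split=> //=; lia.
exists (lim_window a) => e e0; split.
  by apply: limsup_window_lt; rewrite EFinD fineK// lteDl.
move=> N; apply: contrapT => noN.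
have : (limsup_window a <= (lim_window a - e)%:E)%E.
  apply: (@limsup_window_le _ _ N) => m n mn Nmn.
  rewrite leNgt; apply/negP => ?.
  by apply: noN; exists m, n.
by rewrite -(fineK fina) lee_fin -/(lim_window a); lra.
Qed.

End Windows.

(** * Finite nets and uniform bounds on a compact metric space *)

Section CompactMetric.
Context {R : realType} {X : metricType R}.

Lemma nbhs_mdist_lt (x : X) (e : R) : 0 < e -> nbhs x [set y | mdist x y < e].
Proof. by move=> e0; have := nbhsx_ballx x e e0; rewrite ballEmdist. Qed.

Lemma nbhs_mdist_ex (x : X) (P : set X) : nbhs x P ->
  exists2 d : R, 0 < d & forall y, mdist x y < d -> P y.
Proof. by move/metricType_numDomainType.nbhs_mdistP => [d d0 dP]; exists d. Qed.

Lemma continuous_mdist_ex (f : X -> R) (x : X) (e : R) :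
  {for x, continuous f} -> 0 < e ->
  exists2 d : R, 0 < d & forall y, mdist x y < d -> `|f x - f y| < e.
Proof.
by move=> fx e0; apply: nbhs_mdist_ex; by move: fx => /cvgrPdist_lt; apply.
Qed.

Lemma continuous_mdist (x : X) : continuous (mdist x : X -> R).
Proof.
move=> y; apply/cvgrPdist_lt => e e0.
apply: filterS (nbhs_mdist_lt y e0) => z /= yz.
have := metric_triangle x y z; have := metric_triangle x z y.
by rewrite (metric_sym z y) ltr_norml; lra.
Qed.

Hypothesis compactX : compact [set: X].

Lemma compact_mdist_net (r : R) : 0 < r ->
  exists D : seq X, forall x, exists2 z, z \in D & mdist z x < r.
Proof.
move=> r0; have /compact_near_coveringP cov := compactX.
(* Finite sequences are directed by inclusion; compactness turns the one-point nets around each [x]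
   into a single sequence good for all points. *)
pose F := filter_from [set: seq X] (fun D => [set E : seq X | {subset D <= E}]).
have FF : Filter F.
  apply: filter_from_filter; first by exists [::].
  move=> D E _ _; exists (D ++ E) => // G DEG; split=> z zG; apply: DEG.
    by rewrite mem_cat zG.
  by rewrite mem_cat zG orbT.
have [|D _ /(_ D) covD] :=
    cov _ F (fun D x => exists2 z, z \in D & mdist z x < r) FF.
  move=> x _; exists ([set y | mdist x y < r],
    [set E : seq X | {subset [:: x] <= E}]).
    by split; [exact: nbhs_mdist_lt | exists [:: x]].
  by move=> [y E] /= [xy xE]; exists x => //; apply: xE; rewrite inE.
by exists D => x; exact: covD.
Qed.

Lemma compact_bounded_fun (f : X -> R) : continuous f ->
  exists2 M, 0 <= M & forall x, `|f x| <= M.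
Proof.
move=> cf.
have /compact_near_coveringP cov := compactX.
have : \forall M \near +oo, [set: X] `<=` (fun a => `|f a| <= M).
  apply: cov => x _.
  exists ([set y | `|f x - f y| < 1], [set M | `|f x| + 1 <= M]).
    split; first by move: (cf x) => /cvgrPdist_lt; apply.
    exact: nbhs_pinfty_ge.
  move=> [y M] /= [xy]; apply: le_trans.
  by have := ler_normB (f x) (f x - f y); rewrite opprB addrC subrK; lra.
move=> fM; have [M [M0 {}fM]] : exists M : R, 0 <= M /\
    [set: X] `<=` (fun a => `|f a| <= M).
  near +oo_R => M; exists M; split; near: M => //.
  exact: nbhs_pinfty_ge.
by exists M => // x; exact: fM.
Unshelve. all: by end_near. Qed.

(** Close pairs are handled by continuity; for pairs at distance at least [d / 2], a slope [C] of at
    least [4 * M / d] already exceeds the oscillation [2 * M]. Here [d] depends on the base point,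
    and compactness yields a common [C]. *)
Lemma compact_lipschitz_up_to (f : X -> R) (e : R) : continuous f -> 0 < e ->
  exists2 C, 0 <= C & forall a b, `|f a - f b| <= e + C * mdist a b.
Proof.
move=> cf e0.
have [M M0 fM] := compact_bounded_fun cf.
have /compact_near_coveringP cov := compactX.
have : \forall C \near +oo,
    [set: X] `<=` (fun a => forall b, `|f a - f b| <= e + C * mdist a b).
  apply: cov => x _.
  have e20 : 0 < e / 2 by lra.
  have [d d0 xd] := continuous_mdist_ex (cf x) e20.
  exists ([set y | mdist x y < d / 2], [set C | 4 * M / d <= C]).
    split; first by apply: nbhs_mdist_lt (divr_gt0 _ _).
    by apply: nbhs_pinfty_ge; exact: num_real.
  move=> [a C] /= [xa MC] b.
  have C0 : 0 <= C by apply: le_trans MC; rewrite divr_ge0 ?mulr_ge0//; lra.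
  have [ab|ab] := ltP (mdist a b) (d / 2).
    have xb : mdist x b < d by have := metric_triangle x a b; lra.
    have xad : mdist x a < d by lra.
    have := xd _ xb; have := xd _ xad.
    have := ler_distD (f x) (f a) (f b); rewrite (distrC (f a) (f x)).
    have := mulr_ge0 C0 (mdist_ge0 a b); lra.
  have : 4 * M / d * (d / 2) <= C * mdist a b.
    by apply: ler_pM => //; [rewrite divr_ge0 ?mulr_ge0//; lra|lra].
  have -> : 4 * M / d * (d / 2) = 2 * M by field; lra.
  by have := ler_normB (f a) (f b); have := fM a; have := fM b; lra.
move=> fC; have [C [C0 {}fC]] : exists C : R, 0 <= C /\
    [set: X] `<=` (fun a => forall b, `|f a - f b| <= e + C * mdist a b).
  near +oo_R => C; exists C; split; near: C => //.
  exact: nbhs_pinfty_ge.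
by exists C => // a b; exact: fC.
Unshelve. all: by end_near. Qed.

End CompactMetric.

(** * Time averages compared along two orbits *)

Section Averages.
Context {R : realType} {X : metricType R}.
Variable T : X -> X.
Implicit Types (f : X -> R) (x y : X) (m n : nat).

Lemma time_average_normr_le f M x m n : (m < n)%N -> (forall x, `|f x| <= M) ->
  `|time_average T f x m n| <= M.
Proof.
move=> mn fM; have mn0 : 0 < (n - m)%:R :> R by rewrite ltr0n subn_gt0.
rewrite /time_average normrM ger0_norm ?invr_ge0 ?ler0n// mulrC ler_pdivrMr//.
apply: (le_trans (ler_norm_sum _ _ _)).
by rewrite mulr_natr -sumr_const_nat; apply: ler_sum => k _; exact: fM.
Qed.

Lemma time_averageN f x m n :
  time_average T (fun z => - f z) x m n = - time_average T f x m n.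
Proof. by rewrite /time_average sumrN mulrN. Qed.

Lemma window_permsP m n (s : 'S_n) : s \in window_perms m n ->
  forall k : 'I_n, (m <= s k)%N = (m <= k)%N.
Proof.
rewrite !inE => sW k; have := perm_closed k sW.
by rewrite !finset.in_set.
Qed.

Lemma sum_window_perm (g : nat -> R) m n (s : 'S_n) : s \in window_perms m n ->
  \sum_(k < n | (m <= k)%N) g (s k) = \sum_(m <= k < n) g k.
Proof.
move=> /window_permsP sW; rewrite big_geq_mkord /= [RHS](reindex_perm s)/=.
by apply: eq_bigl => k; rewrite sW.
Qed.

(** A permutation of the window does not change the sum along the orbit of [y], so the two sums can
    be compared term by term along a permutation of cost below [c]. *)
Lemma time_average_BF_window (compactX : compact [set: X]) f (e : R) :
  continuous f -> 0 < e ->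
  exists2 C, 0 <= C & forall x y m n c, (m < n)%N -> BF_window T x y m n < c ->
    `|time_average T f x m n - time_average T f y m n| <= e + C * c.
Proof.
move=> cf e0; have [C C0 fC] := compact_lipschitz_up_to compactX cf e0.
exists C => // x y m n c mn.
have mn0 : 0 < (n - m)%:R :> R by rewrite ltr0n subn_gt0.
move=> /inf_lt[|_ [s /= sW <-] ltc].
  by apply: image_nonempty; exists 1%g => /=; exact: group1.
rewrite /time_average -mulrBr normrM ger0_norm ?invr_ge0 ?ler0n//.
rewrite -(sum_window_perm (fun k => f (iter k T y)) sW) big_geq_mkord -sumrB.
apply: (@le_trans _ _ ((n - m)%:R^-1 *
    \sum_(k < n | (m <= k)%N) (e + C * mdist (iter k T x) (iter (s k) T y)))).
  rewrite ler_pM2l ?invr_gt0//; apply: (le_trans (ler_norm_sum _ _ _)).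
  by apply: ler_sum => k _; exact: fC.
rewrite big_split /= -mulr_sumr mulrDr mulrCA lerD ?ler_wpM2l ?(ltW ltc)//.
rewrite -(big_geq_mkord _ _ xpredT (fun=> e)) sumr_const_nat -(mulr_natr e).
by rewrite mulrCA mulVf ?mulr1// gt_eqF.
Qed.

Lemma time_average_equicontinuous (compactX : compact [set: X]) f x (e : R) :
  weak_Banach_mean_equicontinuous T -> continuous f -> 0 < e ->
  exists2 d : R, 0 < d & forall y, mdist x y < d ->
    exists N, forall m n, (m < n)%N -> (N <= n - m)%N ->
      `|time_average T f x m n - time_average T f y m n| <= e.
Proof.
move=> wbme cf e0.
have e20 : 0 < e / 2 by lra.
have [C C0 fC] := time_average_BF_window compactX cf e20.
(* [C] times this threshold is at most [e / 2]; adding 1 covers [C = 0]. *)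
have c0 : 0 < e / 2 / (C + 1) by rewrite !divr_gt0//; lra.
have [d d0 xd] := wbme x _ c0; exists d => // y /xd /limsup_window_lt[N BFN].
exists N => m n mn Nmn; apply: (le_trans (fC _ _ _ _ _ mn (BFN _ _ mn Nmn))).
have : e / 2 / (C + 1) * (C + 1) = e / 2 by field; lra.
by rewrite mulrDr mulr1 mulrC; lra.
Qed.

End Averages.

(** * Cutting a window into short blocks *)

Section Blocks.
Context {R : realType}.
Implicit Types (u : nat -> R) (C : R).

(** Blocks of nonpositive sum are removed from the left until at most [K] terms remain, each at most
    [C]. *)
Lemma sum_blocks_le u C K : 0 <= C -> (forall k, u k <= C) ->
  (forall m, exists l, [/\ (0 < l)%N, (l <= K)%N &
    \sum_(m <= k < m + l) u k <= 0]) ->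
  forall m n, \sum_(m <= k < n) u k <= C * K%:R.
Proof.
move=> C0 uC blocks m n.
have [j] := ubnP (n - m)%N; elim: j m => // j IHj m nmj.
have [nmK|Knm] := leqP (n - m) K.
  apply: (@le_trans _ _ (\sum_(m <= k < n) C)); first exact: ler_sum.
  by rewrite sumr_const_nat -(mulr_natr C) ler_wpM2l// ler_nat.
have [l [l0 lK suml]] := blocks m.
rewrite (@big_cat_nat _ _ _ (m + l)%N) /=; [|lia|lia].
by rewrite -[leRHS]add0r lerD// IHj//; lia.
Qed.

End Blocks.

(** * Existence and continuity of the uniform averages *)

Section LimitExists.
Context {R : realType} {X : metricType R}.
Variable T : X -> X.
Implicit Types (f : X -> R) (x y : X) (m n : nat) (c L e : R).

Lemma sum_time_averageB f x m n c : (m < n)%N ->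
  \sum_(m <= k < n) (f (iter k T x) - c) =
  (n - m)%:R * (time_average T f x m n - c).
Proof.
move=> mn; have mn0 : (n - m)%:R != 0 :> R by rewrite pnatr_eq0; lia.
by rewrite sumrB sumr_const_nat -(mulr_natl c) mulrBr mulVKf.
Qed.

(** Otherwise a block of length at most [K] with nonpositive sum starts at every time, and
    [sum_blocks_le] bounds all window sums of [f - (L - e)] by a constant. On a window with average
    above [L - e / 2] this sum exceeds [(n - m) * (e / 2)]. *)
Lemma exists_nonneg_block f M x L e K : (forall z, `|f z| <= M) -> 0 < e ->
  (forall N, exists m n, [/\ (m < n)%N, (N <= n - m)%N &
    L - e / 2 < time_average T f x m n]) ->
  exists m, forall l, (l <= K)%N ->
    0 <= \sum_(m <= k < m + l) (f (iter k T x) - (L - e)).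
Proof.
move=> fM e0 largeA; apply: contrapT => nobad.
pose C := M + `|L - e|.
have M0 : 0 <= M by apply: le_trans (fM x).
have C0 : 0 <= C by rewrite addr_ge0.
have uC k : f (iter k T x) - (L - e) <= C.
  apply: le_trans (ler_norm _) _; apply: le_trans (ler_normB _ _) _.
  by rewrite lerD2r.
have blocks m : exists l, [/\ (0 < l)%N, (l <= K)%N &
    \sum_(m <= k < m + l) (f (iter k T x) - (L - e)) <= 0].
  apply: contrapT => nol; apply: nobad; exists m => l lK.
  have [->|l0] := posnP l; first by rewrite addn0 big_geq.
  by rewrite leNgt; apply/negP => /ltW suml; apply: nol; exists l.
have [N CN] : exists N, C * K%:R * 2 / e < N%:R.
  by exists (Num.bound (C * K%:R * 2 / e));
     rewrite archi_boundP// divr_ge0 ?mulr_ge0// ltW.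
have [m [n [mn Nmn largeA_mn]]] := largeA N.
have := sum_blocks_le C0 uC blocks m n; rewrite sum_time_averageB//.
apply/negP; rewrite -ltNge.
have NR : N%:R <= (n - m)%:R :> R by rewrite ler_nat.
have : C * K%:R < (n - m)%:R * (e / 2).
  have := lt_le_trans CN NR; rewrite ltr_pdivrMr//; lra.
move=> /lt_le_trans; apply; rewrite ler_wpM2l//; lra.
Qed.

Lemma continuous_iter (continuousT : continuous T) k : continuous (iter k T).
Proof.
elim: k => [|k IHk] x /=; first exact: cvg_id.
by apply: continuous_comp; [exact: IHk|exact: continuousT].
Qed.

Lemma continuous_orbit_sum (continuousT : continuous T) f c l : continuous f ->
  continuous (fun z => \sum_(0 <= k < l) (f (iter k T z) - c)).
Proof.
move=> cf; elim: l => [|l IHl] x.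
  under eq_fun do rewrite big_geq//; exact: cvg_cst.
under eq_fun do rewrite big_nat_recr//=.
apply: cvgD; first exact: IHl.
apply: cvgB; last exact: cvg_cst.
by apply: continuous_comp; [exact: continuous_iter|exact: cf].
Qed.

Hypotheses (compactX : compact [set: X]) (continuousT : continuous T).
Hypothesis wbme : weak_Banach_mean_equicontinuous T.

Lemma orbit_sum_lower_bound f x L e : continuous f -> 0 < e ->
  (forall e', 0 < e' -> forall N, exists m n, [/\ (m < n)%N, (N <= n - m)%N &
    L - e' < time_average T f x m n]) ->
  exists N C, forall p, (N <= p)%N ->
    C <= \sum_(0 <= k < p) (f (iter k T x) - (L - e)).
Proof.
move=> cf e0 largeA.
have [M M0 fM] := compact_bounded_fun compactX cf.
(* One half of [e] is lost in finding the blocks, whose windows need the margin [e / 4]; the other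
   half is lost in the passage from [y] back to the orbit of [x]. *)
have e20 : 0 < e / 2 by lra.
have e40 : 0 < e / 2 / 2 by lra.
have /choice[m_ m_block] K :=
  exists_nonneg_block K fM e20 (largeA _ e40).
pose y_ K := iter (m_ K) T x.
have [y [_ ycl]] := compactX (fmap_proper_filter y_ eventually_filter) filterT.
have y_near (U : set X) K0 : nbhs y U -> exists2 K, (K0 <= K)%N & U (y_ K).
  move=> yU; have [|_ [[K /= K0K <-] UK]] :=
    ycl (y_ @` [set K | (K0 <= K)%N]) U _ yU.
    by exists K0 => // K /= K0K; exists K.
  by exists K.
have sumE c l m z : \sum_(m <= k < m + l) (f (iter k T z) - c) =
    \sum_(0 <= k < l) (f (iter k T (iter m T z)) - c).
  rewrite -{1}[m]add0n big_addn addKn.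
  by apply: eq_bigr => k _; rewrite iterD.
(* A negative sum of length [l] at [y] would by continuity be negative at some [y_ K] with [l <= K],
   whose block sums are nonnegative up to length [K]. *)
have y_sum l : 0 <= \sum_(0 <= k < l) (f (iter k T y) - (L - e / 2)).
  rewrite leNgt; apply/negP => gy0.
  pose g z := \sum_(0 <= k < l) (f (iter k T z) - (L - e / 2)).
  have gy : nbhs y [set z | g z < 0].
    have := @continuous_orbit_sum continuousT f (L - e / 2) l cf y.
    move=> /cvgr_lt; exact.
  have [K lK /=] := y_near _ l gy.
  by have := m_block K l lK; rewrite sumE leNgt => /negP.
have [d d0 yd] := time_average_equicontinuous compactX y wbme cf e20.
have [K _ /= /yd[N AN]] := y_near _ 0%N (nbhs_mdist_lt y d0).
(* The sum from time [m_ K] on is nonnegative, so the terms before it give the bound; [N.+1] makes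
   the remaining window nonempty and long enough for [AN]. *)
exists (m_ K + N.+1)%N, (\sum_(0 <= k < m_ K) (f (iter k T x) - (L - e))).
move=> p Np.
rewrite [leRHS](@big_cat_nat _ _ _ (m_ K)) /=; [|lia|lia]; rewrite lerDl.
have [q q0 ->] : exists2 q, (N < q)%N & p = (m_ K + q)%N.
  by exists (p - m_ K)%N; lia.
have q0' : (0 < q)%N by lia.
have Nq : (N <= q - 0)%N by lia.
have qR : 0 < (q - 0)%:R :> R by rewrite subn0 ltr0n.
rewrite sumE -/(y_ K); have := y_sum q; have := AN _ _ q0' Nq.
by rewrite !(sum_time_averageB _ _ _ q0') !pmulr_rge0// ler_norml; lra.
Qed.

(** With [L] and [G] the limsups for [f] and [- f], the liminf for [f] is [- G], so convergence
    reduces to [L + G <= 0]. *)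
Lemma cvg_time_average f x : continuous f ->
  exists l, cvg_window (time_average T f x) l.
Proof.
move=> cf; have [M _ fM] := compact_bounded_fun compactX cf.
have cNf : continuous (fun z => - f z) by move=> z; apply: cvgN; exact: cf.
have NfM z : `|- f z| <= M by rewrite normrN.
have [L LA] :=
  limsup_window_bounded (fun m n mn => time_average_normr_le T x mn fM).
have [G GA] :=
  limsup_window_bounded (fun m n mn => time_average_normr_le T x mn NfM).
have LG0 : L + G <= 0.
  (* With this [e], the sums for [f] and [- f] over [[0, p[] add up to [- (2 * e * p)], which cannot
     stay above [C1 + C2]. *)
  rewrite leNgt; apply/negP => LG0; pose e := (L + G) / 4.
  have e0 : 0 < e by rewrite /e; lra.
  have [|N1 [C1 sum1]] := @orbit_sum_lower_bound f x L e cf e0.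
    by move=> e' /LA[].
  have [|N2 [C2 sum2]] := @orbit_sum_lower_bound _ x G e cNf e0.
    by move=> e' /GA[].
  have [p0 Cp0] : exists p, `|C1 + C2| / (2 * e) < p%:R.
    exists (Num.bound (`|C1 + C2| / (2 * e))).
    by rewrite archi_boundP// divr_ge0//; lra.
  pose p := (N1 + N2 + p0)%N.
  have := sum1 p ltac:(lia); have := sum2 p ltac:(lia).
  have : \sum_(0 <= k < p) (f (iter k T x) - (L - e)) +
         \sum_(0 <= k < p) (- f (iter k T x) - (G - e)) = - (2 * e * p%:R).
    rewrite -big_split /=.
    rewrite (eq_bigr (fun=> - (2 * e))); last by move=> k _; rewrite /e; lra.
    by rewrite sumr_const_nat subn0 -(mulr_natr (- (2 * e))) mulNr.
  have : p0%:R <= p%:R :> R by rewrite ler_nat /p; lia.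
  move=> /(lt_le_trans Cp0); rewrite ltr_pdivrMr; last by lra.
  by have := ler_norm (- (C1 + C2)); rewrite normrN; lra.
exists L => e e0; have [N1 AN1] := proj1 (LA e e0).
have [N2 AN2] := proj1 (GA e e0).
exists (maxn N1 N2) => m n mn; rewrite geq_max => /andP[N1mn N2mn].
have := AN1 m n mn N1mn; have := AN2 m n mn N2mn.
by rewrite time_averageN ler_norml; lra.
Qed.

Lemma continuous_uniform_time_average f : continuous f ->
  continuous (uniform_time_average T f).
Proof.
move=> cf x; have limA z :
    cvg_window (time_average T f z) (uniform_time_average T f z).
  have [l Al] := cvg_time_average z cf; have /has_lim_windowP[_ lE] := Al.
  by rewrite /uniform_time_average lE.
apply/cvgrPdist_lt => e e0; have e40 : 0 < e / 4 by lra.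
have [d d0 xd] := time_average_equicontinuous compactX x wbme cf e40.
apply: filterS (nbhs_mdist_lt x d0) => y /= /xd[N1 AN1].
have [N2 AN2] := limA x _ e40; have [N3 AN3] := limA y _ e40.
pose n := (N1 + N2 + N3).+1.
have := AN1 0%N n isT ltac:(lia); have := AN2 0%N n isT ltac:(lia).
have := AN3 0%N n isT ltac:(lia).
by rewrite !ler_norml ltr_norml; lra.
Qed.

End LimitExists.

(** * Continuous cutoffs attached to sets of net points *)

Section Plateau.
Context {R : realType} {X : metricType R}.

(** A truncated sum of cones: 1 within [r] of some centre in [Q], 0 at distance at least [2 * r]
    from all of them. *)
Definition plateau (I : finType) (c : I -> X) (r : R) (Q : {set I})
    (z : X) : R :=
  Num.min 1 (\sum_(i in Q) Num.max 0 (2 - mdist (c i) z / r)).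

Variables (I : finType) (c : I -> X) (r : R).
Hypothesis r0 : 0 < r.
Implicit Types (Q : {set I}) (z : X).

Lemma plateau_ge0 Q z : 0 <= plateau c r Q z.
Proof.
by rewrite le_min ler01 /= sumr_ge0// => i _; rewrite le_max lexx.
Qed.

Lemma plateau_le1 Q z : plateau c r Q z <= 1.
Proof. by rewrite ge_min lexx. Qed.

Lemma plateau_eq1 Q z i : i \in Q -> mdist (c i) z < r -> plateau c r Q z = 1.
Proof.
move=> iQ cz; apply/min_idPl; rewrite (bigD1 i)//= -[leLHS]addr0 lerD//.
  rewrite le_max; apply/orP; right.
  have : mdist (c i) z / r < 1 by rewrite ltr_pdivrMr// mul1r.
  by lra.
by rewrite sumr_ge0// => j _; rewrite le_max lexx.
Qed.

Lemma plateau_eq0 Q z : (forall i, i \in Q -> 2 * r <= mdist (c i) z) ->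
  plateau c r Q z = 0.
Proof.
move=> far; rewrite /plateau big1 ?min_r// => i /far cz; apply/max_idPl.
by rewrite subr_le0 ler_pdivlMr.
Qed.

Lemma continuous_plateau Q : continuous (plateau c r Q).
Proof.
move=> z; apply: continuous_min; first exact: cvg_cst.
apply: cvg_big => [|i _]; first exact: add_continuous.
apply: (@continuous_max R X (fun=> 0) (fun z => 2 - mdist (c i) z / r)).
  exact: cvg_cst.
apply: cvgB; first exact: cvg_cst.
by apply: cvgM; [exact: continuous_mdist|exact: cvg_cst].
Qed.

End Plateau.

(** * From continuous averages to equicontinuity *)

Section Converse.
Context {R : realType} {X : metricType R}.
Variable T : X -> X.
Implicit Types (x y : X) (m n : nat).

Lemma natr_card_sum (I : finType) (S W : {set I}) : S \subset W ->
  #|S|%:R = \sum_(k in W) (k \in S)%:R :> R.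
Proof.
move=> SW; rewrite -sum1_card natr_sum [LHS]big_mkcond [RHS]big_mkcond.
apply: eq_bigr => k _; case: (boolP (k \in S)) => [kS|_]; last by case: ifP.
by rewrite (fintype.subsetP SW).
Qed.

Lemma BF_window_le (I : finType) (c : I -> X) (r B d : R) x y m n :
  (m < n)%N -> 0 < r -> (forall z, exists i, mdist (c i) z < r) ->
  (forall z z' : X, mdist z z' <= B) ->
  (forall Q, time_average T (plateau c r Q) x m n -
             time_average T (plateau c r Q) y m n <= d) ->
  BF_window T x y m n <= 3 * r + B * d.
Proof.
move=> mn r0 net_c distB avg_d.
have B0 : 0 <= B by rewrite -(mdistxx x) distB.
pose W : {set 'I_n} := finset (fun k : 'I_n => (m <= k)%N).
(* The radius is [r + 2 * r]: from [T^k x] to a centre, then from the centre to the edge of the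
   support of its cone. *)
pose e : rel 'I_n := fun k j => mdist (iter k T x) (iter j T y) < 3 * r.
have [s sW [S SW]] := hall_deficiency W e.
set bad := finset _; set nbr := finset _ => cardS.
have nR : 0 < (n - m)%:R :> R by rewrite ltr0n subn_gt0.
have sumW (F : nat -> R) : \sum_(k in W) F k = \sum_(m <= k < n) F k.
  by rewrite big_geq_mkord; apply: eq_bigl => k; rewrite finset.in_set.
have sumWavg (f : X -> R) z : \sum_(k in W) f (iter k T z) =
    (n - m)%:R * time_average T f z m n.
  by rewrite (sumW (fun k => f (iter k T z))) /time_average mulVKf// gt_eqF.
(* The plateau of [Q] is 1 at [T^k x] for [k] in [S], and 0 at [T^j y] for [j] in the window outside
   the neighbours of [S]. *)
pose Q := finset (fun i => [exists k in S, mdist (c i) (iter k T x) < r]).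
have S_le : #|S|%:R <= (n - m)%:R * time_average T (plateau c r Q) x m n.
  rewrite (natr_card_sum SW) -sumWavg; apply: ler_sum => k _.
  have [kS|_] := boolP (k \in S); last exact: plateau_ge0.
  have [i ik] := net_c (iter k T x); rewrite (@plateau_eq1 _ _ _ _ _ _ _ _ i)//.
  by rewrite finset.in_set; apply/existsP; exists k; rewrite kS.
have nbr_ge : (n - m)%:R * time_average T (plateau c r Q) y m n <= #|nbr|%:R.
  have nbrW : nbr \subset W by apply/fintype.subsetP => j;
    rewrite finset.in_set => /andP[].
  rewrite (natr_card_sum nbrW) -sumWavg; apply: ler_sum => j jW.
  have [_|jN] := boolP (j \in nbr); first exact: plateau_le1.
  rewrite plateau_eq0// => i; rewrite finset.in_set => /existsP[k /andP[kS ik]].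
  have : ~~ e k j.
    apply: contra jN => ekj; rewrite finset.in_set jW /=.
    by apply/existsP; exists k; rewrite kS.
  rewrite /e -leNgt; have := metric_triangle (iter k T x) (c i) (iter j T y).
  by rewrite (metric_sym _ (c i)); lra.
have bad_le : #|bad|%:R <= (n - m)%:R * d.
  have : (#|bad| + #|nbr|)%:R <= #|S|%:R :> R by rewrite ler_nat.
  rewrite natrD; have := avg_d Q; rewrite -(ler_pM2l nR) mulrBr; lra.
apply: (@le_trans _ _ ((n - m)%:R^-1 *
    \sum_(k < n | (m <= k)%N) mdist (iter k T x) (iter (s k) T y))).
  apply: ge_inf; last by exists s.
  exists 0 => _ [t _ <-]; rewrite mulr_ge0 ?invr_ge0// sumr_ge0// => k _.
  exact: mdist_ge0.
rewrite mulrC ler_pdivrMr//.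
have badW : bad \subset W.
  by apply/fintype.subsetP => j; rewrite finset.in_set => /andP[].
apply: (@le_trans _ _ (\sum_(k in W) (3 * r + B * (k \in bad)%:R))).
  rewrite [leRHS](eq_bigl (fun k : 'I_n => (m <= k)%N)); last first.
    by move=> k; rewrite finset.in_set.
  apply: ler_sum => k mk.
  have [_|kN] := boolP (k \in bad).
    by rewrite mulr1; have := distB (iter k T x) (iter (s k) T y); lra.
  rewrite mulr0 addr0; apply: ltW; apply: contraNT kN => ekj.
  by rewrite finset.in_set finset.in_set mk.
rewrite big_split /= (sumW (fun=> 3 * r)) sumr_const_nat -mulr_sumr.
rewrite -(natr_card_sum badW) -(mulr_natr (3 * r)) [leRHS]mulrDl lerD2l -mulrA.
by rewrite ler_wpM2l// mulrC.
Qed.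

Lemma weak_Banach_mean_equicontinuous_of_averages
    (compactX : compact [set: X]) :
  (forall f : X -> R, continuous f ->
     (forall x : X, has_lim_window (time_average T f x)) /\
     continuous (uniform_time_average T f)) ->
  weak_Banach_mean_equicontinuous T.
Proof.
move=> avg x e e0.
have [M M0 xM] := compact_bounded_fun compactX (@continuous_mdist R X x).
pose B : R := 2 * M.
have distB (z z' : X) : mdist z z' <= B.
  have := metric_triangle z x z'; have := xM z; have := xM z'.
  rewrite (metric_sym z x) !ger0_norm ?mdist_ge0// /B; lra.
pose r := e / 8; have r0 : 0 < r by rewrite /r; lra.
have [D netD] := compact_mdist_net compactX r0.
pose c (i : seq_sub D) : X := ssval i.
have net_c z : exists i, mdist (c i) z < r.
  by have [a aD az] := netD z; exists (SeqSub aD).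
(* The averages at [x] and [y] differ by at most [3 * d]: one [d] for each limit and one between the
   limits. The total [3 * r + B * (3 * d)] is then at most [5 * e / 8]. *)
pose d := e / (12 * (B + 1)).
have B0 : 0 <= B by rewrite /B; lra.
have d0 : 0 < d by rewrite divr_gt0// mulr_gt0//; lra.
have Bd : B * (3 * d) <= e / 4.
  have : d * (12 * (B + 1)) = e by rewrite divfK//; lra.
  have := mulr_ge0 B0 (ltW d0); lra.
have cont_avg Q := proj2 (avg _ (@continuous_plateau _ _ _ c r Q)).
have lim_avg Q z : cvg_window (time_average T (plateau c r Q) z)
    (uniform_time_average T (plateau c r Q) z).
  apply/has_lim_windowP; split=> //.
  exact: (proj1 (avg _ (@continuous_plateau _ _ _ c r Q))).
(* The index type of the net is finite, so finitely many [Q] share one neighbourhood, and below one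
   window length. *)
have : \forall y \near x, forall Q,
    `|uniform_time_average T (plateau c r Q) x -
      uniform_time_average T (plateau c r Q) y| < d.
  by apply: filter_forall => Q; move: (cont_avg Q x) => /cvgrPdist_lt; apply.
move=> /nbhs_mdist_ex[del del0 xdel]; exists del => // y /xdel {}xdel.
have lim_all z : \forall N \near \oo, forall Q m n,
    (m < n)%N -> (N <= n - m)%N ->
    `|time_average T (plateau c r Q) z m n -
      uniform_time_average T (plateau c r Q) z| <= d.
  apply: filter_forall => Q; have [N AN] := lim_avg Q z _ d0.
  by exists N => // N' /= NN' m n mn N'mn; apply: AN => //; lia.
have [N [limx limy]] := filter_ex (filterI (lim_all x) (lim_all y)).
apply: (@le_lt_trans _ _ (3 * r + B * (3 * d))%:E); last first.
  by rewrite lte_fin /r; lra.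
apply: (@limsup_window_le _ _ _ N) => m n mn Nmn.
apply: (BF_window_le (c := c)) => // Q.
have := limx Q m n mn Nmn; have := limy Q m n mn Nmn; have := xdel Q.
by rewrite !ler_norml ltr_norml; lra.
Qed.

End Converse.

Theorem theorem6p12 (R : realType) (X : metricType R) (T : X -> X)
    (compactX : compact [set: X]) (continuousT : continuous T) :
  weak_Banach_mean_equicontinuous T <->
  (forall f : X -> R, continuous f ->
     (forall x : X, has_lim_window (time_average T f x)) /\
     continuous (uniform_time_average T f)).
Proof.
split=> [wbme f cf|]; last exact: weak_Banach_mean_equicontinuous_of_averages.
split=> [x|]; last exact: continuous_uniform_time_average.
have [l Al] := cvg_time_average compactX continuousT wbme x cf.
by have /has_lim_windowP[] := Al.
Qed.
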